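(* Let $\gamma\in\mathfrak{M}^1$ be nonzero and let $\Omega\subset\mathbb{R}^{2d}$ be measurable, and suppose that $$\frac{\int_\Omega\|\mathfrak{V}_\gamma\tau(z)\|_{\mathcal{S}^2}\,dz}{\int_{\mathbb{R}^{2d}}\|\mathfrak{V}_\gamma\tau(z)\|_{\mathcal{S}^2}\,dz}<\frac12\qquad\text{for every nonzero }\tau\in\mathfrak{M}^1.$$ Then for every $\rho\in\mathfrak{M}^1$, $$\rho=\operatorname*{arg\,min}_{\sigma\in\mathfrak{M}^1}\|\mathfrak{V}_\gamma\sigma\|_{L^1(\mathbb{R}^{2d},\mathcal{S}^2)}\quad\text{subject to}\quad\mathfrak{V}_\gamma\sigma|_{\Omega^c}=\mathfrak{V}_\gamma\rho|_{\Omega^c}.$$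
   Context: $\mathcal{S}^2$ is the space of Hilbert–Schmidt operators on $L^2(\mathbb{R}^d)$. For $z=(x,\omega)\in\mathbb{R}^{2d}$, $(\pi(z)g)(t)=g(t-x)e^{2\pi i\omega\cdot t}$. For $\gamma,\rho\in\mathcal{S}^2$, $\mathfrak{V}_\gamma\rho(z)=\gamma^*\pi(z)^*\rho\in\mathcal{S}^2$. With $h_0(t)=2^{d/4}e^{-\pi|t|^2}$ and $\gamma_0=h_0\otimes h_0$ (where $(f\otimes g)(h)=\langle h,g\rangle f$), $\mathfrak{M}^1$ is the Banach space of operators $\rho$ with $\mathfrak{V}_{\gamma_0}\rho\in L^1(\mathbb{R}^{2d},\mathcal{S}^2)$ (Bochner space); it is contained in $\mathcal{S}^2$ and also described as $\{\gamma\in\mathcal{S}^2:\mathfrak{V}_\gamma\gamma\in L^1(\mathbb{R}^{2d},\mathcal{S}^2)\}$. For nonzero $\gamma\in\mathfrak{M}^1$, $\rho\mapsto\|\mathfrak{V}_\gamma\rho\|_{L^1(\mathbb{R}^{2d},\mathcal{S}^2)}$ is an equivalent norm on $\mathfrak{M}^1$. $\Omega^c=\mathbb{R}^{2d}\setminus\Omega$. *)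

(* Defs.v *)
From HB Require Import structures.
From mathcomp Require Import all_boot all_order all_algebra generic_quotient ring_quotient.
From mathcomp Require Import complex.
From mathcomp Require Import all_classical all_reals all_analysis.
From mathcomp Require Import measurable_realfun.
From mathcomp Require Import ring lra.
Set Implicit Arguments.
Unset Strict Implicit.
Unset Printing Implicit Defensive.
Import Order.TTheory GRing.Theory Num.Theory.
Import numFieldNormedType.Exports.
Local Open Scope classical_set_scope.
Local Open Scope quotient_scope.
Local Open Scope complex_scope.
Local Open Scope ring_scope.

Section lebesgue_cons.
Context {R : realType} (n : nat).
Variable mu : {sigma_finite_measure set (n.-tuple (measurableTypeR R)) -> \bar R}.

Definition tcons (p : measurableTypeR R * n.-tuple (measurableTypeR R)) :
  n.+1.-tuple (measurableTypeR R) := [tuple of p.1 :: p.2].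

Lemma measurable_tcons : measurable_fun setT tcons.
Proof. exact: measurable_cons. Qed.

Definition lebesgue_cons : set (n.+1.-tuple (measurableTypeR R)) -> \bar R :=
  pushforward (@lebesgue_measure R \x mu)%E tcons.

Let preimage_measurable A : measurable A -> measurable (tcons @^-1` A).
Proof. by move=> mA; rewrite -[X in measurable X]setTI; exact: measurable_tcons. Qed.

Let lebesgue_cons0 : lebesgue_cons set0 = 0%E.
Proof. by rewrite /lebesgue_cons /pushforward preimage_set0 measure0. Qed.

Let lebesgue_cons_ge0 A : (0 <= lebesgue_cons A)%E.
Proof. by rewrite /lebesgue_cons /pushforward measure_ge0. Qed.

Let lebesgue_cons_sigma_additive : semi_sigma_additive lebesgue_cons.
Proof.
move=> F mF tF mUF; rewrite /lebesgue_cons /pushforward preimage_bigcup.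
apply: measure_semi_sigma_additive.
- by move=> k; exact: preimage_measurable.
- apply/trivIsetP => i j _ _ ij; rewrite -preimage_setI.
  by move/trivIsetP : tF => /(_ _ _ Logic.I Logic.I ij) ->; rewrite preimage_set0.
- by rewrite -preimage_bigcup; exact: preimage_measurable.
Qed.

HB.instance Definition _ := isMeasure.Build _ _ _ lebesgue_cons
  lebesgue_cons0 lebesgue_cons_ge0 lebesgue_cons_sigma_additive.

Let lebesgue_cons_sigma_finite : sigma_finite setT lebesgue_cons.
Proof.
have /sigma_finiteP[F [TF ndF Foo]] :=
  sigma_finiteT [the {sigma_finite_measure set _ -> \bar R} of @lebesgue_measure R].
have /sigma_finiteP[G [TG ndG Goo]] := sigma_finiteT mu.
pose uncons (t : n.+1.-tuple (measurableTypeR R)) := (thead t, [tuple of behead t]).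
have tconsK : cancel tcons uncons.
  by move=> [x t]; congr (_, _); apply: val_inj.
have muncons : measurable_fun setT uncons.
  apply/measurable_fun_pairP; split; last exact: measurable_behead.
  exact: measurable_tnth.
exists (fun k => uncons @^-1` (F k `*` G k)).
  rewrite -preimage_bigcup; apply/esym; rewrite -subTset => t _.
  have [i _ Fi] : (\bigcup_i F i) (uncons t).1 by rewrite -TF.
  have [j _ Gj] : (\bigcup_j G j) (uncons t).2 by rewrite -TG.
  exists (maxn i j) => //; split.
  - by move/subsetPset : (ndF _ _ (leq_maxl i j)); apply.
  - by move/subsetPset : (ndG _ _ (leq_maxr i j)); apply.
move=> k; have [[mF Fkoo] [mG Gkoo]] := (Foo k, Goo k); split.
  by rewrite -[X in measurable X]setTI; apply: muncons => //; exact: measurableX.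
rewrite /lebesgue_cons /pushforward (_ : _ @^-1` _ = F k `*` G k); last first.
  by apply/funext => p; rewrite -[in RHS](tconsK p).
rewrite [ltLHS](product_measure1E
  [the {measure set _ -> \bar R} of @lebesgue_measure R] mu mF mG).
by apply: lte_mul_pinfty => //; rewrite ge0_fin_numE.
Qed.

HB.instance Definition _ := Measure_isSigmaFinite.Build _ _ _ lebesgue_cons
  lebesgue_cons_sigma_finite.

End lebesgue_cons.

(* Lebesgue measure on $R^n$, as an iterated product of the Lebesgue measure on
   the line, transported along $R \times R^n \cong R^{n+1}$. *)
Fixpoint lebesgue_tuple {R : realType} (n : nat) :
    {sigma_finite_measure set (n.-tuple (measurableTypeR R)) -> \bar R} :=
  if n is m.+1 then [the {sigma_finite_measure set _ -> \bar R} of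
                       lebesgue_cons (@lebesgue_tuple R m)]
  else [the {sigma_finite_measure set _ -> \bar R} of
          @dirac _ (0.-tuple (measurableTypeR R)) [tuple] R].

Section complex_L2.
Context {R : realType} {disp : measure_display} {T : measurableType disp}.
Variable mu : {measure set T -> \bar R}.
Implicit Types f g : T -> R[i].

Definition cmeasurable f :=
  measurable_fun setT (fun t => complex.Re (f t)) /\
  measurable_fun setT (fun t => complex.Im (f t)).

Definition cintegral f : R[i] :=
  (\int[mu]_t complex.Re (f t)) +i* (\int[mu]_t complex.Im (f t)).

Definition square_integrable : {pred T -> R[i]} := fun f =>
  `[< cmeasurable f /\ (\int[mu]_t ((Normc.normc (f t)) ^+ 2)%:E < +oo)%E >].

Let normc2 (z : R[i]) : Normc.normc z ^+ 2 = complex.Re z ^+ 2 + complex.Im z ^+ 2.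
Proof. by case: z => a b; rewrite sqr_sqrtr// addr_ge0// sqr_ge0. Qed.

Let normc2D (z w : R[i]) :
  Normc.normc (z + w) ^+ 2 <= 2 * Normc.normc z ^+ 2 + 2 * Normc.normc w ^+ 2.
Proof.
case: z w => [a b] [c d]; rewrite !normc2/= -subr_ge0.
rewrite (_ : _ - _ = (a - c) ^+ 2 + (b - d) ^+ 2); last by ring.
by rewrite addr_ge0// sqr_ge0.
Qed.

Let cmeasurable_normc2 f : cmeasurable f ->
  measurable_fun setT (fun t => ((Normc.normc (f t)) ^+ 2)%:E).
Proof.
move=> [mRe mIm]; apply/measurable_EFinP.
rewrite (_ : (fun t => _) = fun t => complex.Re (f t) ^+ 2 + complex.Im (f t) ^+ 2); last first.
  by apply/funext => t; rewrite normc2.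
by apply: measurable_funD; exact: measurable_funX.
Qed.

Lemma square_integrable_submod : submod_closed square_integrable.
Proof.
split.
  apply/asboolP; split; first by split; exact: measurable_cst.
  rewrite (_ : (fun t => _) = cst 0%E) ?integral0//.
  by apply/funext => t; rewrite normc2 /= expr0n addr0.
move=> a f g /asboolP[mf f2] /asboolP[mg g2].
have mafg : cmeasurable (a *: f + g).
  case: a => a b; case: mf => mf1 mf2; case: mg => mg1 mg2; split.
    rewrite (_ : (fun t => _) = fun t => (a * complex.Re (f t) - b * complex.Im (f t)) +
      complex.Re (g t)); last first.
      by apply/funext => t /=; rewrite !fctE; case: (f t); case: (g t).
    by apply: measurable_funD => //; apply: measurable_funB; exact: measurable_funM.
  rewrite (_ : (fun t => _) = fun t => (a * complex.Im (f t) + b * complex.Re (f t)) +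
      complex.Im (g t)); last first.
    by apply/funext => t /=; rewrite !fctE; case: (f t); case: (g t).
  by apply: measurable_funD => //; apply: measurable_funD; exact: measurable_funM.
apply/asboolP; split => //.
have [mf' mg'] := (cmeasurable_normc2 mf, cmeasurable_normc2 mg).
set c := 2 * (Normc.normc a ^+ 2) : R.
have c0 : 0 <= c by rewrite mulr_ge0// sqr_ge0.
apply: (@le_lt_trans _ _ (\int[mu]_t (c%:E * ((Normc.normc (f t)) ^+ 2)%:E +
    2%:E * ((Normc.normc (g t)) ^+ 2)%:E))%E); last first.
  rewrite ge0_integralD//=; last 4 first.
  - by move=> t _; rewrite -EFinM lee_fin mulr_ge0// sqr_ge0.
  - exact: measurable_funeM.
  - by move=> t _; rewrite -EFinM lee_fin mulr_ge0// sqr_ge0.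
  - exact: measurable_funeM.
  rewrite !ge0_integralZl_EFin//; try by move=> t _; rewrite lee_fin sqr_ge0.
  by rewrite lte_add_pinfty// lte_mul_pinfty// lee_fin.
apply: ge0_le_integral => //=.
- by move=> t _; rewrite lee_fin sqr_ge0.
- exact: cmeasurable_normc2.
- by apply: emeasurable_funD; exact: measurable_funeM.
move=> t _; rewrite -!EFinM -EFinD lee_fin /c -mulrA -exprMn -Normc.normcM.
exact: normc2D.
Qed.

HB.instance Definition _ := GRing.isSubmodClosed.Build _ _ square_integrable
  square_integrable_submod.

(* $\mathcal{L}^2$: functions, not yet identified almost everywhere *)
Record L2fun := MkL2fun { L2fun_val :> T -> R[i] ; _ : L2fun_val \in square_integrable }.

HB.instance Definition _ := [isSub for L2fun_val].
HB.instance Definition _ := [Choice of L2fun by <:].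
HB.instance Definition _ := [SubChoice_isSubLmodule of L2fun by <:].

Definition ae_zero : {pred L2fun} := fun u => `[< {ae mu, forall t, u t = 0} >].

Lemma ae_zero_submod : submod_closed ae_zero.
Proof.
split; first by apply/asboolP; apply/nearW => t.
move=> a f g /asboolP f0 /asboolP g0; apply/asboolP.
by apply: filterS2 f0 g0 => t ft gt; rewrite [LHS]/(a * f t + g t) ft gt mulr0; exact: (addr0 (0 : R[i])).
Qed.

HB.instance Definition _ := GRing.isSubmodClosed.Build _ _ ae_zero ae_zero_submod.

Definition L2 := Quotient.quot ae_zero.
HB.instance Definition _ := GRing.Zmodule.on L2.

Definition L2scale (a : R[i]) : L2 -> L2 := lift_op1 L2 ( *:%R a).

Let pi_scale a : {morph \pi_L2 : u / a *: u >-> L2scale a u}.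
Proof.
move=> u; unlock L2scale; apply/eqP.
by rewrite -Quotient.idealrBE -scalerBr rpredZ// Quotient.idealrBE reprK.
Qed.

Canonical pi_scale_morph a := PiMorph1 (pi_scale a).

Let L2scaleA a b (u : L2) : L2scale a (L2scale b u) = L2scale (a * b) u.
Proof. by elim/quotW: u => u; rewrite !piE scalerA. Qed.

Let L2scale1 : left_id 1 L2scale.
Proof. by elim/quotW => u; rewrite !piE scale1r. Qed.

Let L2scaleDr : right_distributive L2scale +%R.
Proof.
by move=> a; elim/quotW => u; elim/quotW => v; rewrite !piE scalerDr.
Qed.

Let L2scaleDl (u : L2) : {morph L2scale^~ u : a b / a + b}.
Proof. by elim/quotW: u => u a b /=; rewrite !piE scalerDl. Qed.

HB.instance Definition _ := GRing.Zmodule_isLmodule.Build R[i] L2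
  L2scaleA L2scale1 L2scaleDr L2scaleDl.

End complex_L2.

Section L2_operators.
Context {R : realType} {disp : measure_display} {T : measurableType disp}.
Variable mu : {measure set T -> \bar R}.

(* Junk value: if f is not square integrable then [toL2 f = 0]. *)
Definition toL2 (f : T -> R[i]) : L2 mu := \pi_(L2 mu) (insubd (0 : L2fun mu) f).

(* Linear in the first argument. *)
Definition inner (f g : L2 mu) : R[i] :=
  cintegral mu (fun t => (repr f : L2fun mu) t * conjc ((repr g : L2fun mu) t)).

Definition L2norm (f : L2 mu) : R := Num.sqrt (complex.Re (inner f f)).

Definition orthonormal (E : set (L2 mu)) :=
  forall e f, E e -> E f -> inner e f = (e == f)%:R.

(* A maximal orthonormal set. *)
Definition orthonormal_basis (E : set (L2 mu)) :=
  orthonormal E /\ forall f, (forall e, E e -> inner f e = 0) -> f = 0.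

Definition bounded_operator (A : L2 mu -> L2 mu) :=
  linear A /\ exists M : R, forall f, L2norm (A f) <= M * L2norm f.

(* For a bounded operator the sum does not depend on the basis; one basis of
   $L^2$ is fixed once and for all. *)
Definition the_basis : set (L2 mu) := xget set0 orthonormal_basis.

Definition hs_norm (A : L2 mu -> L2 mu) : \bar R :=
  ((\esum_(e in the_basis) ((L2norm (A e)) ^+ 2)%:E) `^ 2^-1)%E.

Definition hilbert_schmidt : set (L2 mu -> L2 mu) :=
  [set A | bounded_operator A /\ (hs_norm A < +oo)%E].

(* The Hilbert space adjoint of a bounded operator. Junk value: 0 if there is
   no B satisfying the defining identity. *)
Definition adjoint (A : L2 mu -> L2 mu) : L2 mu -> L2 mu :=
  xget 0 [set B | forall f g, inner (B f) g = inner f (A g)].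

Definition rank_one (f g : L2 mu) : L2 mu -> L2 mu := fun h => inner h g *: f.

(* Bochner spaces of functions with values in the Hilbert-Schmidt operators,
   normed by [hs_norm]; strong measurability is approximation everywhere by
   simple functions. *)
Section bochner.
Context {disp' : measure_display} {U : measurableType disp'}.
Variable nu : {measure set U -> \bar R}.
Implicit Type F : U -> L2 mu -> L2 mu.

Definition hs_simple F :=
  [/\ forall z, hilbert_schmidt (F z), finite_set (range F) &
      forall A, measurable (F @^-1` [set A])].

Definition hs_strongly_measurable F := exists s : nat -> U -> L2 mu -> L2 mu,
  (forall n, hs_simple (s n)) /\
  (forall z, (fun n => hs_norm (s n z - F z)) @ \oo --> (0 : \bar R)).

Definition bochner_norm1 F : \bar R := (\int[nu]_z hs_norm (F z))%E.

Definition bochner_L1 : set (U -> L2 mu -> L2 mu) :=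
  [set F | [/\ forall z, hilbert_schmidt (F z), hs_strongly_measurable F &
               (bochner_norm1 F < +oo)%E]].

End bochner.
End L2_operators.

Section time_frequency.
Variables (R : realType) (d : nat).

Definition point : measurableType _ :=
  [the measurableType _ of d.-tuple (measurableTypeR R)].

Definition lebesgue_point : {sigma_finite_measure set point -> \bar R} :=
  lebesgue_tuple d.

Definition phase_space : measurableType _ :=
  [the measurableType _ of (point * point)%type].

Definition lebesgue_phase : {measure set phase_space -> \bar R} :=
  [the {measure set (point * point)%type -> \bar R} of
     (lebesgue_point \x lebesgue_point)%E].

Definition L2Rd := L2 lebesgue_point.

Definition dotp (x y : point) : R := \sum_(i < d) tnth x i * tnth y i.

(* $\pi(x, \omega)$. Lebesgue measure is translation invariant, so the class
   does not depend on the representative of g. *)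
Definition tf_shift (z : phase_space) (g : L2Rd) : L2Rd :=
  toL2 lebesgue_point (fun t : point =>
    let a := 2 * pi * dotp z.2 t in
    (repr g : L2fun lebesgue_point) [tuple tnth t i - tnth z.1 i | i < d] *
    (cos a +i* sin a)).

Definition gaussian : L2Rd :=
  toL2 lebesgue_point (fun t : point =>
    (2 `^ (d%:R / 4) * expR (- pi * dotp t t))%:C).

Definition gamma0 : L2Rd -> L2Rd := rank_one gaussian gaussian.

(* $\mathfrak{V}_\gamma\rho(z) = \gamma^* \pi(z)^* \rho$ *)
Definition opSTFT (gamma rho : L2Rd -> L2Rd) : phase_space -> L2Rd -> L2Rd :=
  fun z => adjoint gamma \o adjoint (tf_shift z) \o rho.

Definition M1 : set (L2Rd -> L2Rd) :=
  [set rho | hilbert_schmidt rho /\ bochner_L1 lebesgue_phase (opSTFT gamma0 rho)].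

End time_frequency.
Arguments M1 : clear implicits.

(* Measurability for the completed measure: equal to a set of the underlying
   $\sigma$-algebra up to a null set. *)
Definition measurable_completed {disp} {T : measurableType disp} {R : realType}
    (mu : {measure set T -> \bar R}) (A : set T) :=
  exists2 B, measurable B & mu.-negligible ((A `\` B) `|` (B `\` A)).

(* The set of all minimizers. *)
Definition argmin {T : Type} {R : realType} (C : set T) (F : T -> \bar R) : set T :=
  [set x | C x /\ forall y, C y -> (F x <= F y)%E].

(* Main.v *)
Require Import Defs.
From mathcomp Require Import all_boot all_order all_algebra complex.
From mathcomp Require Import generic_quotient ring_quotient.
From mathcomp Require Import all_classical all_reals all_analysis.
From mathcomp Require Import measurable_realfun.
From mathcomp Require Import ring lra.
Import Order.TTheory GRing.Theory Num.Theory.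
Import numFieldNormedType.Exports.
Local Open Scope classical_set_scope.
Local Open Scope ring_scope.

(** Suppose that sigma in M^1 satisfies the constraint, and put
    tau = sigma - rho. By linearity V_gamma tau = V_gamma sigma - V_gamma rho
    vanishes almost everywhere off Omega, so all of the L^1 norm of V_gamma tau
    is carried by Omega. If tau were nonzero this would contradict the
    hypothesis, which allows Omega to carry less than one half of that norm:
    strict inequality excludes the values 0 and +oo as well. Hence the
    constraint set is {rho}, and rho is its only minimizer.

    The lemmas that carry this argument are:
    - [M1B]: tau belongs to M^1. This requires the triangle inequality for the
      Hilbert-Schmidt norm ([hs_normB]) and the measurability of the norm of a
      strongly measurable function ([measurable_hs_norm]).
    - [opSTFTB]: V_gamma is additive, because every adjoint is ([adjointB]),
      which in turn follows from additivity and nondegeneracy of the inner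
      product on the quotient L^2.
    - [integral_le_of_ae0_outside]: a nonnegative function that vanishes almost
      everywhere off a set has its whole integral on that set.

    Both triangle inequalities, in L^2 and for Hilbert-Schmidt operators, are
    obtained from the pointwise inequality
      |z - w|^2 <= (1 + e) |z|^2 + (1 + 1/e) |w|^2   for every e > 0,
    which is stable under integration and summation, by optimizing e at the
    end ([sqrt_le_of_young]). *)

(** * Young's inequality and the modulus of complex numbers *)

(** With e = b / a the right-hand side is (a + b)^2. As a and b may vanish,
    both are first enlarged by c / 2 and c then tends to 0. *)
Lemma sqrt_le_of_young (R : rcfType) (s a b : R) : 0 <= a -> 0 <= b ->
  (forall e, 0 < e -> s <= (1 + e) * a ^+ 2 + (1 + e^-1) * b ^+ 2) ->
  Num.sqrt s <= a + b.
Proof.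
move=> a0 b0 young; apply/ler_addgt0Pr => c c0.
have c20 : 0 < c / 2 by rewrite divr_gt0.
set a' := a + c / 2; set b' := b + c / 2.
have a'0 : 0 < a' by rewrite ltr_wpDl.
have b'0 : 0 < b' by rewrite ltr_wpDl.
have -> : a + b + c = a' + b' by rewrite /a' /b'; field.
have -> : a' + b' = Num.sqrt ((a' + b') ^+ 2).
  by rewrite sqrtr_sqr ger0_norm// ltW// addr_gt0.
apply: ler_wsqrtr.
apply: (le_trans (young _ (divr_gt0 b'0 a'0))).
have -> : (a' + b') ^+ 2 = (1 + b' / a') * a' ^+ 2 + (1 + (b' / a')^-1) * b' ^+ 2.
  by field; rewrite !lt0r_neq0.
apply: lerD; apply: ler_wpM2l.
- by rewrite addr_ge0// divr_ge0 ?ltW.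
- by apply: lerXn2r; rewrite ?nnegrE ?(ltW a'0)// lerDl ltW.
- by rewrite addr_ge0// invr_ge0 divr_ge0 ?ltW.
- by apply: lerXn2r; rewrite ?nnegrE ?(ltW b'0)// lerDl ltW.
Qed.

Section complex_modulus.
Context {R : rcfType}.
Implicit Types z w : R[i].

Lemma normc_sqr z : Normc.normc z ^+ 2 = complex.Re z ^+ 2 + complex.Im z ^+ 2.
Proof. by case: z => a b; rewrite sqr_sqrtr// addr_ge0// sqr_ge0. Qed.

Lemma normcB_young z w (e : R) : 0 < e ->
  Normc.normc (z - w) ^+ 2 <=
  (1 + e) * Normc.normc z ^+ 2 + (1 + e^-1) * Normc.normc w ^+ 2.
Proof.
move=> e0; rewrite !normc_sqr; case: z w => [a b] [c d] /=; rewrite -subr_ge0.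
rewrite [leRHS](_ : _ = e * ((a + e^-1 * c) ^+ 2 + (b + e^-1 * d) ^+ 2)).
  by rewrite mulr_ge0 ?(ltW e0)// addr_ge0// sqr_ge0.
by field; rewrite lt0r_neq0.
Qed.

Lemma Re_mul_conj z w : complex.Re (z * conjc w) =
  complex.Re z * complex.Re w + complex.Im z * complex.Im w.
Proof. by case: z w => [a b] [c d] /=; ring. Qed.

Lemma Im_mul_conj z w : complex.Im (z * conjc w) =
  complex.Im z * complex.Re w - complex.Re z * complex.Im w.
Proof. by case: z w => [a b] [c d] /=; ring. Qed.

End complex_modulus.

(** * The Hilbert space L^2 as a quotient *)

Section L2_theory.
Context {R : realType} {disp : measure_display} {T : measurableType disp}.
Context {mu : {measure set T -> \bar R}}.
Implicit Types (f g : L2fun mu) (u v w : L2 mu).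
Local Notation rep u := (repr u : L2fun mu).

Lemma L2fun_measurable f : cmeasurable f.
Proof. by case: f => f /= /asboolP[]. Qed.

Lemma L2fun_finite f : (\int[mu]_t ((Normc.normc (f t)) ^+ 2)%:E < +oo)%E.
Proof. by case: f => f /= /asboolP[]. Qed.

Lemma measurable_normc2 f :
  measurable_fun setT (fun t => Normc.normc (f t) ^+ 2).
Proof.
have [mRe mIm] := L2fun_measurable f.
under eq_fun do rewrite normc_sqr.
by apply: measurable_funD; exact: measurable_funX.
Qed.

Lemma ae_eq_of_eqmod f g : (f = g %[mod L2 mu])%qT -> {ae mu, forall t, f t = g t}.
Proof.
move/eqP; rewrite -Quotient.idealrBE => /asboolP; apply: filterS => t fg.
by apply/eqP; rewrite -subr_eq0; apply/eqP.
Qed.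

(** Choosing representatives is additive only up to a null set, since both sides
    represent the same class. *)
Lemma repB u v : {ae mu, forall t, rep (u - v) t = rep u t - rep v t}.
Proof.
apply: (@ae_eq_of_eqmod (rep (u - v)) (rep u - rep v)).
by rewrite reprK raddfB/= !reprK.
Qed.

Lemma integrable_normc2 f :
  mu.-integrable setT (fun t => (Normc.normc (f t) ^+ 2)%:E).
Proof.
apply/integrableP; split; first by apply/measurable_EFinP; exact: measurable_normc2.
under eq_integral do rewrite gee0_abs ?lee_fin ?sqr_ge0//.
exact: L2fun_finite.
Qed.

Lemma integrable_dominated f g (h : T -> R) : measurable_fun setT h ->
  (forall t, `|h t| <= Normc.normc (f t) ^+ 2 + Normc.normc (g t) ^+ 2) ->
  mu.-integrable setT (EFin \o h).
Proof.
move=> mh hle; apply: (@le_integrable _ _ _ mu _ measurableT _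
  ((fun t => (Normc.normc (f t) ^+ 2)%:E) \+ (fun t => (Normc.normc (g t) ^+ 2)%:E))%E).
- exact/measurable_EFinP.
- move=> t _ /=; rewrite lee_fin [leRHS]ger0_norm ?addr_ge0 ?sqr_ge0//.
- by apply: integrableD => //; exact: integrable_normc2.
Qed.

Lemma measurable_Re_mul_conj f g :
  measurable_fun setT (fun t => complex.Re (f t * conjc (g t))).
Proof.
have [[fr fi] [gr gi]] := (L2fun_measurable f, L2fun_measurable g).
under eq_fun do rewrite Re_mul_conj.
by apply: measurable_funD; exact: measurable_funM.
Qed.

Lemma measurable_Im_mul_conj f g :
  measurable_fun setT (fun t => complex.Im (f t * conjc (g t))).
Proof.
have [[fr fi] [gr gi]] := (L2fun_measurable f, L2fun_measurable g).
under eq_fun do rewrite Im_mul_conj.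
by apply: measurable_funB; exact: measurable_funM.
Qed.

Lemma integrable_Re_mul_conj f g :
  mu.-integrable setT (EFin \o (fun t => complex.Re (f t * conjc (g t)))).
Proof.
apply: (@integrable_dominated f g); first exact: measurable_Re_mul_conj.
move=> t; rewrite Re_mul_conj !normc_sqr ler_norml.
case: (f t) (g t) => [a b] [c d] /=.
by have := (sqr_ge0 (a + c), sqr_ge0 (b + d), sqr_ge0 (a - c), sqr_ge0 (b - d),
 sqr_ge0 a, sqr_ge0 b, sqr_ge0 c, sqr_ge0 d) => -[[[[[[[]]]]]]]; nra.
Qed.

Lemma integrable_Im_mul_conj f g :
  mu.-integrable setT (EFin \o (fun t => complex.Im (f t * conjc (g t)))).
Proof.
apply: (@integrable_dominated f g); first exact: measurable_Im_mul_conj.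
move=> t; rewrite Im_mul_conj !normc_sqr ler_norml.
case: (f t) (g t) => [a b] [c d] /=.
by have := (sqr_ge0 (b + c), sqr_ge0 (a + d), sqr_ge0 (b - c), sqr_ge0 (a - d),
 sqr_ge0 a, sqr_ge0 b, sqr_ge0 c, sqr_ge0 d) => -[[[[[[[]]]]]]]; nra.
Qed.

(** Real and imaginary parts of the integrand are dominated by |f|^2 + |g|^2, so
    that the integrals may be subtracted. *)
Lemma innerB u v w : inner (u - v) w = inner u w - inner v w.
Proof.
have ReB f := integrable_Re_mul_conj f (rep w).
have ImB f := integrable_Im_mul_conj f (rep w).
apply/eqP; rewrite eq_complex; apply/andP; split; apply/eqP => /=.
- rewrite -RintegralB//; congr fine; apply: ae_eq_integral => //.
  + by apply/measurable_EFinP; exact: measurable_Re_mul_conj.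
  + by apply/measurable_EFinP; apply: measurable_funB; exact: measurable_Re_mul_conj.
  + apply: filterS (repB u v) => t uv _ /=.
    by rewrite uv mulrBl raddfB.
- rewrite -RintegralB//; congr fine; apply: ae_eq_integral => //.
  + by apply/measurable_EFinP; exact: measurable_Im_mul_conj.
  + by apply/measurable_EFinP; apply: measurable_funB; exact: measurable_Im_mul_conj.
  + apply: filterS (repB u v) => t uv _ /=.
    by rewrite uv mulrBl raddfB.
Qed.

(** Passing to the extended-real integral gives access to the monotonicity of
    the integral for nonnegative functions. *)
Lemma L2norm_sqr u :
  ((L2norm u ^+ 2)%:E = \int[mu]_t (Normc.normc (rep u t) ^+ 2)%:E)%E.
Proof.
have ge0 : (0 <= \int[mu]_t (Normc.normc (rep u t) ^+ 2)%:E)%E.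
  by apply: integral_ge0 => t _; rewrite lee_fin sqr_ge0.
have ReE : complex.Re (inner u u) =
    fine (\int[mu]_t (Normc.normc (rep u t) ^+ 2)%:E)%E.
  congr fine; apply: eq_integral => t _.
  by rewrite Re_mul_conj normc_sqr !expr2.
by rewrite /L2norm ReE sqr_sqrtr ?fine_ge0// fineK// ge0_fin_numE// L2fun_finite.
Qed.

Lemma L2norm_ge0 u : 0 <= L2norm u. Proof. exact: sqrtr_ge0. Qed.

Lemma L2norm_eq0 u : L2norm u = 0 -> u = 0.
Proof.
move=> u0; have := L2norm_sqr u; rewrite u0 expr0n /= => /esym int0.
have /ae_eq_integral_abs : (\int[mu]_t `|(Normc.normc (rep u t) ^+ 2)%:E| = 0)%E.
  by under eq_integral do rewrite gee0_abs ?lee_fin ?sqr_ge0//.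
have mN : measurable_fun setT (fun t => (Normc.normc (rep u t) ^+ 2)%:E).
  by apply/measurable_EFinP; exact: measurable_normc2.
move=> /(_ measurableT mN) ae0; rewrite -[u]reprK -[RHS](raddf0 (\pi_(L2 mu))%qT).
apply/eqP; rewrite -Quotient.idealrBE subr0; apply/asboolP.
apply: filterS ae0 => t /(_ Logic.I) [] /eqP.
by rewrite sqrf_eq0 => /eqP/Normc.eq0_normc.
Qed.

Lemma L2norm0 : L2norm (0 : L2 mu) = 0.
Proof.
by rewrite /L2norm -{1}(subrr (0 : L2 mu)) innerB subrr sqrtr0.
Qed.

Lemma L2normB_young u v (e : R) : 0 < e -> L2norm (u - v) ^+ 2 <=
  (1 + e) * L2norm u ^+ 2 + (1 + e^-1) * L2norm v ^+ 2.
Proof.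
move=> e0; have [c0 d0] : 0 <= 1 + e /\ 0 <= 1 + e^-1.
  by split; rewrite addr_ge0// ?invr_ge0 ltW.
have mE f : measurable_fun setT (fun t => (Normc.normc (f t) ^+ 2)%:E).
  by apply/measurable_EFinP; exact: measurable_normc2.
have ge0 f t : (0 <= (Normc.normc (f t) ^+ 2)%:E)%E by rewrite lee_fin sqr_ge0.
rewrite -lee_fin EFinD (EFinM (1 + e)) (EFinM (1 + e^-1)) !L2norm_sqr.
rewrite -!ge0_integralZl_EFin// -ge0_integralD//; last 4 first.
- by move=> t _; rewrite mule_ge0// lee_fin.
- exact: measurable_funeM.
- by move=> t _; rewrite mule_ge0// lee_fin.
- exact: measurable_funeM.
apply: ae_ge0_le_integral => //.
- by move=> t _; rewrite adde_ge0// mule_ge0// lee_fin.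
- by apply: emeasurable_funD; exact: measurable_funeM.
- apply: filterS (repB u v) => t -> _.
  by rewrite -!EFinM -EFinD lee_fin normcB_young.
Qed.

Lemma L2normB u v : L2norm (u - v) <= L2norm u + L2norm v.
Proof.
rewrite -[leLHS]ger0_norm ?L2norm_ge0// -sqrtr_sqr.
by apply: sqrt_le_of_young => *; rewrite ?L2norm_ge0// L2normB_young.
Qed.

Lemma inner_nondegenerate u v : (forall w, inner u w = inner v w) -> u = v.
Proof.
move=> uv; apply/eqP; rewrite -subr_eq0; apply/eqP/L2norm_eq0.
by rewrite /L2norm innerB uv subrr sqrtr0.
Qed.

End L2_theory.

(** * The Hilbert-Schmidt norm *)

Section hilbert_schmidt_norm.
Context {R : realType} {disp : measure_display} {T : measurableType disp}.
Context {mu : {measure set T -> \bar R}}.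
Implicit Types A B : L2 mu -> L2 mu.

Lemma esumZ_le {I : choiceType} (D : set I) (a : I -> \bar R) (k : R) :
  0 <= k -> (forall i, 0 <= a i)%E ->
  (\esum_(i in D) (k%:E * a i) <= k%:E * \esum_(i in D) a i)%E.
Proof.
move=> k0 a0; apply: ge_ereal_sup => _ [X [finX XD] <-].
rewrite -ge0_mule_fsumr// lee_wpmul2l ?lee_fin// esum_ge//.
by exists X.
Qed.

Lemma hs_norm_ge0 A : (0 <= hs_norm A)%E.
Proof. exact: poweR_ge0. Qed.

Lemma hs_norm0 : hs_norm (0 : L2 mu -> L2 mu) = 0%E.
Proof.
rewrite /hs_norm esum1 ?poweR0r ?invr_eq0// => e _.
by rewrite [X in L2norm X](_ : _ = 0)// L2norm0 expr0n.
Qed.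

Lemma hs_norm_fin A : (hs_norm A < +oo)%E -> exists2 a : R, 0 <= a &
  hs_norm A = a%:E /\
  (\esum_(e in the_basis (mu:=mu)) ((L2norm (A e)) ^+ 2)%:E)%E = (a ^+ 2)%:E.
Proof.
rewrite /hs_norm => /lty_poweRy; rewrite invr_eq0 pnatr_eq0 => /(_ isT).
set s := (\esum_(e in _) _)%E.
have s0 : (0 <= s)%E by apply: esum_ge0 => e _; rewrite lee_fin sqr_ge0.
move=> soo; have sE : s = (fine s)%:E by rewrite fineK// ge0_fin_numE.
exists (Num.sqrt (fine s)); first exact: sqrtr_ge0.
rewrite sqr_sqrtr ?fine_ge0// -sE; split => //.
by rewrite poweR12_sqrt// {1}sE.
Qed.

(** Minkowski's inequality for the square-summable families of norms on the
    basis: Young's inequality is summed with the weight e fixed, and e is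
    optimized only for the sums. *)
Lemma hs_normB A B : (hs_norm (A - B)%R <= hs_norm A + hs_norm B)%E.
Proof.
have [Aoo|] := ltP (hs_norm A) +oo%E; last first.
  by rewrite leye_eq => /eqP ->; rewrite addye ?leey// gt_eqF// (lt_le_trans _ (hs_norm_ge0 B)).
have [Boo|] := ltP (hs_norm B) +oo%E; last first.
  by rewrite leye_eq => /eqP ->; rewrite addey ?leey// gt_eqF// (lt_le_trans _ (hs_norm_ge0 A)).
have [a a0 [-> Aa]] := hs_norm_fin _ Aoo.
have [b b0 [-> Bb]] := hs_norm_fin _ Boo.
rewrite /hs_norm; set s := (\esum_(e in _) _)%E.
have s0 : (0 <= s)%E by apply: esum_ge0 => e _; rewrite lee_fin sqr_ge0.
have young e : 0 < e ->
    (s <= ((1 + e) * a ^+ 2 + (1 + e^-1) * b ^+ 2)%:E)%E.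
  move=> e0; have [c0 d0] : 0 <= 1 + e /\ 0 <= 1 + e^-1.
    by split; rewrite addr_ge0// ?invr_ge0 ltW.
  rewrite EFinD (EFinM (1 + e)) (EFinM (1 + e^-1)) -Aa -Bb.
  apply: le_trans (leeD (esumZ_le _ _ _ c0 _) (esumZ_le _ _ _ d0 _)); last 2 first.
  - by move=> i; rewrite lee_fin sqr_ge0.
  - by move=> i; rewrite lee_fin sqr_ge0.
  rewrite -esumD; [|by move=> i _; rewrite mule_ge0 ?lee_fin ?sqr_ge0..].
  by apply: le_esum => i _; rewrite -!EFinM -EFinD lee_fin L2normB_young.
have sE : s = (fine s)%:E.
  by rewrite fineK// ge0_fin_numE// (le_lt_trans (young 1 _))// ltry.
rewrite poweR12_sqrt// sE /= lee_fin; apply: sqrt_le_of_young => // e e0.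
by rewrite -lee_fin -sE young.
Qed.

(** Deduced from the triangle inequality for 0 - A. *)
Lemma hs_normN A : hs_norm (- A) = hs_norm A.
Proof.
have leN B : (hs_norm (- B)%R <= hs_norm B)%E.
  by rewrite -[- B]add0r (le_trans (hs_normB _ _))// hs_norm0 add0e.
by apply/eqP; rewrite eq_le leN -{1}[A]opprK leN.
Qed.

Lemma hs_normD A B : (hs_norm (A + B)%R <= hs_norm A + hs_norm B)%E.
Proof. by rewrite -{1}[B]opprK -(hs_normN B) hs_normB. Qed.

Lemma hilbert_schmidtB A B :
  hilbert_schmidt A -> hilbert_schmidt B -> hilbert_schmidt (A - B).
Proof.
move=> [[linA [M Mle]] Aoo] [[linB [N Nle]] Boo]; split; last first.
  by rewrite (le_lt_trans (hs_normB _ _))// lte_add_pinfty.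
split.
  move=> c u v; rewrite !fctE linA linB scalerBr opprD.
  exact: addrACA.
exists (M + N) => f; rewrite mulrDl (le_trans (L2normB _ _))// lerD//.
Qed.

End hilbert_schmidt_norm.

(** * Bochner integrable functions form an additive group *)

Section bochner_space.
Context {R : realType} {disp : measure_display} {T : measurableType disp}.
Context {mu : {measure set T -> \bar R}}.
Context {disp' : measure_display} {U : measurableType disp'}.
Variable nu : {measure set U -> \bar R}.
Implicit Types F G : U -> L2 mu -> L2 mu.

(** A simple function factors through its finite range, so its composite with
    an arbitrary map is measurable. *)
Lemma measurable_hs_simple {disp''} {V : measurableType disp''} F
  (h : (L2 mu -> L2 mu) -> V) : hs_simple F -> measurable_fun setT (h \o F).
Proof.
move=> [_ finF mF] _ Y mY; rewrite setTI.
have -> : (h \o F) @^-1` Y =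
    \bigcup_(A in range F `&` h @^-1` Y) (F @^-1` [set A]).
  apply/seteqP; split => [z hz|z [A [_ hA] FA]].
    by exists (F z) => //; split => //; exists z.
  by rewrite /preimage/= FA.
by apply: fin_bigcup_measurable => //; exact: finite_setIl.
Qed.

Lemma hs_simpleB F G : hs_simple F -> hs_simple G -> hs_simple (F - G).
Proof.
move=> [hF finF mF] [hG finG mG]; split.
- by move=> z; exact: hilbert_schmidtB.
- apply: (@sub_finite_set _ _
    ((fun p => p.1 - p.2) @` (range F `*` range G))).
    move=> _ [z _ <-]; exists (F z, G z) => //; split; by exists z.
  by apply: finite_image; exact: finite_setX.
- move=> A.
  have -> : (F - G) @^-1` [set A] = \bigcup_(B in range F)
     (F @^-1` [set B] `&` G @^-1` [set B - A]).
    apply/seteqP; split => [z FGA|z [B _ [FB GB]]].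
      exists (F z); first by exists z.
      split => //; rewrite /preimage/= -FGA.
      by rewrite -[(F - G) z]/(F z - G z) opprB addrC subrK.
    rewrite /preimage/= -[(F - G) z]/(F z - G z).
    by rewrite FB GB opprB addrC subrK.
  by apply: fin_bigcup_measurable => // B _; exact: measurableI.
Qed.

Lemma hs_strongly_measurableB F G : hs_strongly_measurable F ->
  hs_strongly_measurable G -> hs_strongly_measurable (F - G).
Proof.
move=> [s [ss sF]] [t [tt tG]]; exists (fun n => s n - t n); split.
  by move=> n; exact: hs_simpleB.
move=> z; apply: (@squeeze_cvge _ _ _ _ (fun=> 0%E) _
    (fun n => hs_norm (s n z - F z)%R + hs_norm (t n z - G z)%R)%E).
- apply: nearW => n; rewrite hs_norm_ge0/=.
  rewrite (_ : _ - _ = (s n z - F z) - (t n z - G z)); first exact: hs_normB.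
  rewrite -[LHS]/((s n z - t n z) - (F z - G z)).
  by rewrite !opprD !opprK addrACA.
- exact: cvg_cst.
- rewrite -[X in _ --> X]adde0; apply: cvgeD => //.
Qed.

(** The norm of F is the pointwise limit of the norms of simple functions, by
    the reverse triangle inequality | ||s|| - ||F|| | <= ||s - F||. *)
Lemma measurable_hs_norm F : (forall z, hilbert_schmidt (F z)) ->
  hs_strongly_measurable F -> measurable_fun setT (fun z => hs_norm (F z)).
Proof.
move=> hF [s [ss sF]].
apply: (@emeasurable_fun_cvg _ _ _ _ (fun n z => hs_norm (s n z))).
  by move=> n; exact: (@measurable_hs_simple _ _ (s n) (@hs_norm _ _ _ mu)).
have fin (A : L2 mu -> L2 mu) : hilbert_schmidt A -> hs_norm A \is a fin_num.
  by move=> [_ Aoo]; rewrite ge0_fin_numE// hs_norm_ge0.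
move=> z _; have Ffin := fin _ (hF z).
apply: (@squeeze_cvge _ _ _ _ (fun n => hs_norm (F z) - hs_norm (s n z - F z)%R)%E _
    (fun n => hs_norm (F z) + hs_norm (s n z - F z)%R)%E).
- apply: nearW => n; apply/andP; split.
    rewrite leeBlDr; last first.
      by apply/fin/hilbert_schmidtB => //; case: (ss n).
    have := hs_normB (s n z) (s n z - F z).
    by rewrite opprB [s n z + _]addrC subrK.
  have := hs_normD (F z) (s n z - F z).
  by rewrite [F z + _]addrC subrK.
- rewrite -[X in _ --> X]sube0; apply: cvgeB => //; last exact: cvg_cst.
  by rewrite fin_num_adde_defl.
- rewrite -[X in _ --> X]adde0; apply: cvgeD => //; last exact: cvg_cst.
  by rewrite fin_num_adde_defr.
Qed.

Lemma bochner_L1B F G : bochner_L1 nu F -> bochner_L1 nu G ->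
  bochner_L1 nu (F - G).
Proof.
move=> [hF mF Foo] [hG mG Goo]; split.
- by move=> z; exact: hilbert_schmidtB.
- exact: hs_strongly_measurableB.
- apply: (@le_lt_trans _ _ (\int[nu]_z (hs_norm (F z) + hs_norm (G z)))%E).
    apply: ge0_le_integral => //.
    + by move=> z _; exact: hs_norm_ge0.
    + apply: measurable_hs_norm; last exact: hs_strongly_measurableB.
      by move=> z; exact: hilbert_schmidtB.
    + by apply: emeasurable_funD; exact: measurable_hs_norm.
    + by move=> z _; exact: hs_normB.
  rewrite ge0_integralD//.
  + exact: lte_add_pinfty Foo Goo.
  + by move=> z _; exact: hs_norm_ge0.
  + exact: measurable_hs_norm.
  + by move=> z _; exact: hs_norm_ge0.
  + exact: measurable_hs_norm.
Qed.
End bochner_space.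

(** * Additivity of the adjoint *)

Section adjoint.
Context {R : realType} {disp : measure_display} {T : measurableType disp}.
Context {mu : {measure set T -> \bar R}}.
Implicit Types (A : L2 mu -> L2 mu) (f g : L2 mu).

(** Either [adjoint A] satisfies the identity that defines the adjoint, and is
    additive by nondegeneracy of the inner product, or it is the zero map. In
    both cases it is additive, whatever A is. *)
Lemma adjointB A f g : adjoint A (f - g) = adjoint A f - adjoint A g.
Proof.
rewrite /adjoint; case: xgetP => [B _ adjB|_].
  by apply: inner_nondegenerate => w; rewrite innerB !adjB innerB.
exact: esym (subrr (0 : L2 mu)).
Qed.

End adjoint.

(** * Integrals of functions concentrated on a set *)

Section lower_integral.
Context {disp : measure_display} {T : measurableType disp} {R : realType}.
Context {mu : {measure set T -> \bar R}}.
Import HBNNSimple.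

(** Membership in M^1 gives measurability of the norm of V_gamma tau only for the
    Gaussian window, so f is arbitrary here. The integral of a nonnegative f
    is the supremum of the integrals of the simple functions h below f; cutting h
    off on a null set outside which f vanishes off D leaves its integral
    unchanged and makes it a simple function below the restriction of f to D. *)
Lemma integral_le_of_ae0_outside (D : set T) (f : T -> \bar R) :
  (forall x, 0 <= f x)%E -> {ae mu, forall x, (~` D) x -> f x = 0%E} ->
  (\int[mu]_x f x <= \int[mu]_(x in D) f x)%E.
Proof.
move=> f0 [N [mN N0 subN]].
rewrite [leLHS]ge0_integralE// [leRHS]ge0_integralE// patch_setT.
apply: ge_ereal_sup => _ [h /= hf <-].
have mNC : measurable (~` N) by exact: measurableC.
apply: ereal_sup_ubound => /=; exists (proj_nnsfun h mNC).
  move=> x; rewrite /proj_nnsfun /= mindicE patchE.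
  case: ifPn => xD; last first.
    have [/set_mem xN|] := boolP (x \in ~` N); last by rewrite mulr0.
    have fx0 : f x = 0%E.
      apply: contrapT => fx; apply/xN/subN => /= Dx.
      by apply/fx/Dx; move/negP: xD; rewrite inE.
    by have := hf x; rewrite fx0 mulr1.
  apply: le_trans (hf x); rewrite lee_fin -[leRHS]mulr1 ler_wpM2l//.
  by case: (_ \in _); rewrite ?ler01.
rewrite -!integralT_nnsfun.
apply: ge0_ae_eq_integral => //.
- by apply/measurable_EFinP; exact: measurable_funP.
- by apply/measurable_EFinP; exact: measurable_funP.
- by move=> x _; rewrite lee_fin.
- by move=> x _; rewrite lee_fin.
exists N; split => // x /= /not_implyP [_ hx].
by apply: contrapT => xN; apply: hx; rewrite mindicE mem_set ?mulr1.
Qed.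
End lower_integral.

(** * Uniqueness of the operator with prescribed transform off Omega *)

Section operator_modulation_space.
Context {R : realType} {d : nat}.
Implicit Types gamma rho sigma : L2Rd R d -> L2Rd R d.

Lemma opSTFTB gamma rho sigma z :
  opSTFT gamma (sigma - rho) z = opSTFT gamma sigma z - opSTFT gamma rho z.
Proof. by apply/funext => f; rewrite /opSTFT /= !fctE/= !adjointB. Qed.

Lemma M1B rho sigma : M1 R d sigma -> M1 R d rho -> M1 R d (sigma - rho).
Proof.
move=> [hsigma Lsigma] [hrho Lrho]; split; first exact: hilbert_schmidtB.
rewrite (_ : opSTFT _ (sigma - rho) = opSTFT (gamma0 (d:=d)) sigma - opSTFT (gamma0 (d:=d)) rho).
  exact: bochner_L1B.
by apply/funext => z; rewrite opSTFTB.
Qed.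

(** If sigma - rho were nonzero, its transform would be concentrated on Omega,
    which carries less than half of the norm. *)
Lemma M1_eq_of_opSTFT_ae_eq gamma (Omega : set (phase_space R d)) :
  (forall tau, M1 R d tau -> tau <> 0 ->
    (\int[lebesgue_phase R d]_(z in Omega) hs_norm (opSTFT gamma tau z) <
     2^-1%:E * \int[lebesgue_phase R d]_z hs_norm (opSTFT gamma tau z))%E) ->
  forall rho sigma, M1 R d rho -> M1 R d sigma ->
  {ae lebesgue_phase R d, forall z, (~` Omega) z ->
     opSTFT gamma sigma z = opSTFT gamma rho z} -> sigma = rho.
Proof.
move=> half rho sigma rhoM1 sigmaM1 agree; apply: contrapT => neq.
have tau0 : sigma - rho <> 0 by move/eqP; rewrite subr_eq0 => /eqP.
have := half _ (M1B _ _ sigmaM1 rhoM1) tau0; apply/negP; rewrite -leNgt.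
set I := (\int[_]_z _)%E.
have I0 : (0 <= I)%E by apply: integral_ge0 => z _; exact: hs_norm_ge0.
apply: (@le_trans _ _ I).
  by rewrite -[leRHS]mul1e lee_wpmul2r// lee_fin invf_le1// ler1n.
apply: integral_le_of_ae0_outside => [z|]; first exact: hs_norm_ge0.
apply: filterS agree => z eqz /eqz {}eqz.
by rewrite opSTFTB eqz subrr hs_norm0.
Qed.

End operator_modulation_space.

Theorem corollary7p2 (R : realType) (d : nat)
  (gamma : L2Rd R d -> L2Rd R d) (Omega : set (phase_space R d))
  (gammaM1 : M1 R d gamma) (gamma_neq0 : gamma <> 0)
  (mOmega : measurable_completed (lebesgue_phase R d) Omega)
  (Omega_half : forall tau : L2Rd R d -> L2Rd R d, M1 R d tau -> tau <> 0 ->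
    (\int[lebesgue_phase R d]_(z in Omega) hs_norm (opSTFT gamma tau z) <
     2^-1%:E * \int[lebesgue_phase R d]_z hs_norm (opSTFT gamma tau z))%E)
  (rho : L2Rd R d -> L2Rd R d) (rhoM1 : M1 R d rho) :
  argmin
    [set sigma | M1 R d sigma /\
      {ae lebesgue_phase R d, forall z, (~` Omega) z ->
        opSTFT gamma sigma z = opSTFT gamma rho z}]
    (fun sigma => bochner_norm1 (lebesgue_phase R d) (opSTFT gamma sigma))
  = [set rho].
Proof.
have unique := @M1_eq_of_opSTFT_ae_eq _ _ gamma Omega Omega_half rho.
apply/seteqP; split => [sigma [[sigmaM1 agree] _]|_ ->]; first exact: unique.
split; first by split => //; apply: nearW.
by move=> sigma [sigmaM1 agree]; rewrite (unique sigma).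
Qed.
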